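(* Let $f:\mathbb{R}^3\to\mathbb{R}$ be a harmonic function. Then the product $(x^2+y^2-2z^2)\cdot f(x,y,z)$ is harmonic on $\mathbb{R}^3$ if and only if there exist $\alpha,\beta,\gamma\in\mathbb{R}$ such that $f(x,y,z)=\alpha+\beta xyz+\gamma(x^2-y^2)z$ for all $(x,y,z)\in\mathbb{R}^3$. *)

(* Defs.v *)
From Stdlib Require Import Reals.
From Coquelicot Require Import Coquelicot.
Open Scope R_scope.

Definition D1 (f : R -> R -> R -> R) : R -> R -> R -> R :=
  fun x y z => Derive (fun t => f t y z) x.
Definition D2 (f : R -> R -> R -> R) : R -> R -> R -> R :=
  fun x y z => Derive (fun t => f x t z) y.
Definition D3 (f : R -> R -> R -> R) : R -> R -> R -> R :=
  fun x y z => Derive (fun t => f x y t) z.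

(* Joint continuity, for the product topology on R * R * R. *)
Definition continuous3 (f : R -> R -> R -> R) : Prop :=
  forall p : R * R * R,
    continuous (fun q : R * R * R => f (fst (fst q)) (snd (fst q)) (snd q)) p.

(* [Derive] is total, with a junk value where the derivative does not exist,
   so the existence of the partial derivatives is required separately. *)
Definition partially_derivable (f : R -> R -> R -> R) : Prop :=
  forall x y z : R,
    ex_derive (fun t => f t y z) x /\
    ex_derive (fun t => f x t z) y /\
    ex_derive (fun t => f x y t) z.

(* All partial derivatives of order at most k, mixed ones included, exist
   and are continuous on R^3. *)
Fixpoint class_C (k : nat) (f : R -> R -> R -> R) : Prop :=
  match k with
  | O => continuous3 f
  | S k' => continuous3 f /\ partially_derivable f /\
            class_C k' (D1 f) /\ class_C k' (D2 f) /\ class_C k' (D3 f)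
  end.

Definition laplacian (f : R -> R -> R -> R) : R -> R -> R -> R :=
  fun x y z => D1 (D1 f) x y z + D2 (D2 f) x y z + D3 (D3 f) x y z.

Definition harmonic (f : R -> R -> R -> R) : Prop :=
  class_C 2 f /\ forall x y z : R, laplacian f x y z = 0.

(* Main.v *)
(** Since [P = x^2 + y^2 - 2 z^2] is harmonic, the Laplacian of [P f] is
    [P] times that of [f], plus [4 (x f_x + y f_y - 2 z f_z)]; so [P f] is
    harmonic iff [f] is invariant under the flow [(s x, s y, z / s^2)].
    Comparing the Laplace equation along the flow, where [f_xx + f_yy] and [f_zz]
    scale with different powers of [s], gives [f_zz = 0].  Hence
    [f = alpha + z B(x, y)] with [B] homogeneous of degree 2; as [B] is C^2, it is
    a quadratic form, and it is harmonic. *)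

Require Import Defs.
From Stdlib Require Import Reals Lra FunctionalExtensionality.
From Coquelicot Require Import Coquelicot.
Open Scope R_scope.

(** * Closure properties of [class_C] *)

Ltac funext3 := do 3 (apply functional_extensionality; intro).

(* Separate projections: [apply] on the conjunction tries to unify derivatives in
   different variables, which does not terminate in practice. *)
Lemma derivable1 f x y z : partially_derivable f -> ex_derive (fun t => f t y z) x.
Proof. intros h; exact (proj1 (h x y z)). Qed.

Lemma derivable2 f x y z : partially_derivable f -> ex_derive (fun t => f x t z) y.
Proof. intros h; exact (proj1 (proj2 (h x y z))). Qed.

Lemma derivable3 f x y z : partially_derivable f -> ex_derive (fun t => f x y t) z.
Proof. intros h; exact (proj2 (proj2 (h x y z))). Qed.

(** Equalities between functions rather than between values, so that they rewrite under [class_C]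
    and under a second partial derivative. *)
Lemma D_plus (f g : R -> R -> R -> R) :
  partially_derivable f -> partially_derivable g ->
  D1 (fun x y z => f x y z + g x y z) = (fun x y z => D1 f x y z + D1 g x y z) /\
  D2 (fun x y z => f x y z + g x y z) = (fun x y z => D2 f x y z + D2 g x y z) /\
  D3 (fun x y z => f x y z + g x y z) = (fun x y z => D3 f x y z + D3 g x y z).
Proof.
  intros hf hg; split; [| split]; funext3.
  - unfold D1; rewrite Derive_plus; [reflexivity | now apply derivable1 ..].
  - unfold D2; rewrite Derive_plus; [reflexivity | now apply derivable2 ..].
  - unfold D3; rewrite Derive_plus; [reflexivity | now apply derivable3 ..].
Qed.

Lemma D_mult (f g : R -> R -> R -> R) :
  partially_derivable f -> partially_derivable g ->
  D1 (fun x y z => f x y z * g x y z) =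
    (fun x y z => D1 f x y z * g x y z + f x y z * D1 g x y z) /\
  D2 (fun x y z => f x y z * g x y z) =
    (fun x y z => D2 f x y z * g x y z + f x y z * D2 g x y z) /\
  D3 (fun x y z => f x y z * g x y z) =
    (fun x y z => D3 f x y z * g x y z + f x y z * D3 g x y z).
Proof.
  intros hf hg; split; [| split]; funext3.
  - unfold D1; rewrite Derive_mult; [reflexivity | now apply derivable1 ..].
  - unfold D2; rewrite Derive_mult; [reflexivity | now apply derivable2 ..].
  - unfold D3; rewrite Derive_mult; [reflexivity | now apply derivable3 ..].
Qed.

Lemma partially_derivable_plus (f g : R -> R -> R -> R) :
  partially_derivable f -> partially_derivable g ->
  partially_derivable (fun x y z => f x y z + g x y z).
Proof.
  intros hf hg x y z; split; [| split].
  - apply (ex_derive_plus (fun t => f t y z) (fun t => g t y z)); now apply derivable1.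
  - apply (ex_derive_plus (fun t => f x t z) (fun t => g x t z)); now apply derivable2.
  - apply (ex_derive_plus (fun t => f x y t) (fun t => g x y t)); now apply derivable3.
Qed.

Lemma partially_derivable_mult (f g : R -> R -> R -> R) :
  partially_derivable f -> partially_derivable g ->
  partially_derivable (fun x y z => f x y z * g x y z).
Proof.
  intros hf hg x y z; split; [| split].
  - apply (ex_derive_mult (fun t => f t y z) (fun t => g t y z)); now apply derivable1.
  - apply (ex_derive_mult (fun t => f x t z) (fun t => g x t z)); now apply derivable2.
  - apply (ex_derive_mult (fun t => f x y t) (fun t => g x y t)); now apply derivable3.
Qed.

Lemma class_C_continuous3 k f : class_C k f -> continuous3 f.
Proof. destruct k; simpl; tauto. Qed.

Lemma class_C_S k f : class_C (S k) f -> class_C k f.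
Proof.
  revert f; induction k as [|k IH]; intros f (h0 & h & h1 & h2 & h3).
  - exact h0.
  - split; [exact h0 | split; [exact h | repeat split; apply IH; assumption]].
Qed.

Lemma continuous3_plus f g : continuous3 f -> continuous3 g ->
  continuous3 (fun x y z => f x y z + g x y z).
Proof. intros hf hg p; exact (continuous_plus _ _ p (hf p) (hg p)). Qed.

Lemma continuous3_mult f g : continuous3 f -> continuous3 g ->
  continuous3 (fun x y z => f x y z * g x y z).
Proof. intros hf hg p; exact (continuous_mult _ _ p (hf p) (hg p)). Qed.

Lemma class_C_plus k f g : class_C k f -> class_C k g ->
  class_C k (fun x y z => f x y z + g x y z).
Proof.
  revert f g; induction k as [|k IH]; intros f g.
  - apply continuous3_plus.
  - intros (f0 & f' & f1 & f2 & f3) (g0 & g' & g1 & g2 & g3).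
    destruct (D_plus f g f' g') as (e1 & e2 & e3).
    split; [now apply continuous3_plus | split; [now apply partially_derivable_plus |]].
    rewrite e1, e2, e3; auto.
Qed.

Lemma class_C_mult k f g : class_C k f -> class_C k g ->
  class_C k (fun x y z => f x y z * g x y z).
Proof.
  revert f g; induction k as [|k IH]; intros f g.
  - apply continuous3_mult.
  - intros hf hg.
    (* The product rule leaves one factor undifferentiated in each term, so [f] and [g] themselves
       must also be available at order [k]. *)
    pose proof (class_C_S _ _ hf); pose proof (class_C_S _ _ hg).
    destruct hf as (f0 & f' & f1 & f2 & f3), hg as (g0 & g' & g1 & g2 & g3).
    destruct (D_mult f g f' g') as (e1 & e2 & e3).
    split; [now apply continuous3_mult | split; [now apply partially_derivable_mult |]].
    rewrite e1, e2, e3; auto using class_C_plus.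
Qed.

Lemma class_C_const k c : class_C k (fun _ _ _ => c).
Proof.
  revert c; induction k as [|k IH]; intros c.
  - intros p; apply continuous_const.
  - split; [intros p; apply continuous_const |].
    split; [intros x y z; split; [| split]; apply ex_derive_const |].
    assert (e : D1 (fun _ _ _ => c) = (fun _ _ _ => 0) /\
                D2 (fun _ _ _ => c) = (fun _ _ _ => 0) /\
                D3 (fun _ _ _ => c) = (fun _ _ _ => 0)).
    { unfold D1, D2, D3; split; [| split]; funext3; apply Derive_const. }
    destruct e as (-> & -> & ->); auto.
Qed.

Lemma class_C_proj1 k : class_C k (fun x _ _ => x).
Proof.
  assert (hc : continuous3 (fun x _ _ => x)).
  { intros p; apply (continuous_comp fst fst); apply continuous_fst. }
  (* The partial derivatives are constants, whose class is known at every order, so a case split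
     replaces induction. *)
  destruct k as [|k]; [exact hc | split; [exact hc |]].
  split; [intros x y z; split; [apply ex_derive_id | split; apply ex_derive_const] |].
  assert (e : D1 (fun x _ _ => x) = (fun _ _ _ => 1) /\
              D2 (fun x _ _ => x) = (fun _ _ _ => 0) /\
              D3 (fun x _ _ => x) = (fun _ _ _ => 0)).
  { unfold D1, D2, D3; split; [| split]; funext3; [apply Derive_id | apply Derive_const ..]. }
  destruct e as (-> & -> & ->); auto using class_C_const.
Qed.

Lemma class_C_proj2 k : class_C k (fun _ y _ => y).
Proof.
  assert (hc : continuous3 (fun _ y _ => y)).
  { intros p; apply (continuous_comp fst snd); [apply continuous_fst | apply continuous_snd]. }
  destruct k as [|k]; [exact hc | split; [exact hc |]].
  split; [intros x y z; split; [| split];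
          [apply ex_derive_const | apply ex_derive_id | apply ex_derive_const] |].
  assert (e : D1 (fun _ y _ => y) = (fun _ _ _ => 0) /\
              D2 (fun _ y _ => y) = (fun _ _ _ => 1) /\
              D3 (fun _ y _ => y) = (fun _ _ _ => 0)).
  { unfold D1, D2, D3; split; [| split]; funext3;
    [apply Derive_const | apply Derive_id | apply Derive_const]. }
  destruct e as (-> & -> & ->); auto using class_C_const.
Qed.

Lemma class_C_proj3 k : class_C k (fun _ _ z => z).
Proof.
  assert (hc : continuous3 (fun _ _ z => z)) by (intros p; apply continuous_snd).
  destruct k as [|k]; [exact hc | split; [exact hc |]].
  split; [intros x y z; split; [| split]; [apply ex_derive_const .. | apply ex_derive_id] |].
  assert (e : D1 (fun _ _ z => z) = (fun _ _ _ => 0) /\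
              D2 (fun _ _ z => z) = (fun _ _ _ => 0) /\
              D3 (fun _ _ z => z) = (fun _ _ _ => 1)).
  { unfold D1, D2, D3; split; [| split]; funext3; [apply Derive_const .. | apply Derive_id]. }
  destruct e as (-> & -> & ->); auto using class_C_const.
Qed.

(** * The quadratic factor and products with it *)

Definition cone (x y z : R) : R := x ^ 2 + y ^ 2 - 2 * z ^ 2.

Lemma class_C_cone k : class_C k cone.
Proof.
  pose proof (class_C_proj1 k); pose proof (class_C_proj2 k); pose proof (class_C_proj3 k).
  replace cone with
    (fun x y z => (x * x + y * y) + (-2) * (z * z)) by (funext3; unfold cone; ring).
  apply (class_C_plus k (fun x y z => x * x + y * y) (fun x y z => -2 * (z * z))).
  - apply (class_C_plus k (fun x y z => x * x) (fun x y z => y * y)).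
    + apply (class_C_mult k (fun x _ _ => x) (fun x _ _ => x)); assumption.
    + apply (class_C_mult k (fun _ y _ => y) (fun _ y _ => y)); assumption.
  - apply (class_C_mult k (fun _ _ _ => -2) (fun _ _ z => z * z)); [apply class_C_const |].
    apply (class_C_mult k (fun _ _ z => z) (fun _ _ z => z)); assumption.
Qed.

(** The product rule is applied twice in each variable; each cross term appears once per order of
    differentiation, whence the factor 2 on the product of gradients. *)
Lemma laplacian_mult f g : class_C 2 f -> class_C 2 g -> forall x y z,
  laplacian (fun x y z => f x y z * g x y z) x y z =
    laplacian f x y z * g x y z + f x y z * laplacian g x y z +
    2 * (D1 f x y z * D1 g x y z + D2 f x y z * D2 g x y z + D3 f x y z * D3 g x y z).
Proof.
  intros (_ & f' & (_ & f1 & _) & (_ & f2 & _) & (_ & f3 & _))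
         (_ & g' & (_ & g1 & _) & (_ & g2 & _) & (_ & g3 & _)) x y z.
  unfold laplacian.
  destruct (D_mult f g f' g') as (-> & -> & ->).
  destruct (D_plus (fun x y z => D1 f x y z * g x y z) (fun x y z => f x y z * D1 g x y z))
    as (-> & _); [now apply partially_derivable_mult .. |].
  destruct (D_plus (fun x y z => D2 f x y z * g x y z) (fun x y z => f x y z * D2 g x y z))
    as (_ & -> & _); [now apply partially_derivable_mult .. |].
  destruct (D_plus (fun x y z => D3 f x y z * g x y z) (fun x y z => f x y z * D3 g x y z))
    as (_ & _ & ->); [now apply partially_derivable_mult .. |].
  destruct (D_mult (D1 f) g f1 g') as (-> & _), (D_mult f (D1 g) f' g1) as (-> & _).
  destruct (D_mult (D2 f) g f2 g') as (_ & -> & _), (D_mult f (D2 g) f' g2) as (_ & -> & _).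
  destruct (D_mult (D3 f) g f3 g') as (_ & _ & ->), (D_mult f (D3 g) f' g3) as (_ & _ & ->).
  ring.
Qed.

Lemma D_cone :
  D1 cone = (fun x _ _ => 2 * x) /\ D2 cone = (fun _ y _ => 2 * y) /\
  D3 cone = (fun _ _ z => - 4 * z).
Proof.
  unfold D1, D2, D3, cone; split; [| split]; funext3; apply is_derive_unique;
    auto_derive; trivial; ring.
Qed.

Lemma laplacian_cone x y z : laplacian cone x y z = 0.
Proof.
  unfold laplacian; destruct D_cone as (-> & -> & ->); unfold D1, D2, D3.
  rewrite !Derive_scal, !Derive_id; ring.
Qed.

(** Both Laplacians vanish in the product formula, and the gradient of [cone] is [(2x, 2y, -4z)], so
    only 4 times a weighted Euler operator applied to [f] remains. *)
Lemma harmonic_cone_mult f : harmonic f ->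
  harmonic (fun x y z => cone x y z * f x y z) <->
  forall x y z, x * D1 f x y z + y * D2 f x y z - 2 * z * D3 f x y z = 0.
Proof.
  intros (hf & lf).
  assert (lap : forall x y z, laplacian (fun x y z => cone x y z * f x y z) x y z =
    4 * (x * D1 f x y z + y * D2 f x y z - 2 * z * D3 f x y z)).
  { intros x y z; rewrite laplacian_mult by auto using class_C_cone.
    rewrite laplacian_cone, lf; destruct D_cone as (-> & -> & ->); ring. }
  split.
  - intros (_ & h) x y z; specialize (h x y z); rewrite lap in h; lra.
  - intros h; split; [apply class_C_mult; auto using class_C_cone |].
    intros x y z; rewrite lap, h; ring.
Qed.

(** * The chain rule along curves *)

(** Continuity of multiplication with one tolerance for both factors. As [d <= 1], the three terms
    of the expansion sum to less than [d * (1 + Rabs B0 + Rabs A0) = d * M <= eps]. *)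
Lemma mult_close (A0 B0 eps : R) : 0 < eps ->
  exists d, 0 < d /\ forall A B,
    Rabs (A - A0) < d -> Rabs (B - B0) < d -> Rabs (A * B - A0 * B0) < eps.
Proof.
  intros heps; set (M := Rabs A0 + Rabs B0 + 1).
  pose proof (Rabs_pos A0); pose proof (Rabs_pos B0).
  assert (hM : 0 < M) by (unfold M; lra).
  exists (Rmin 1 (eps / M)); split.
  { apply Rmin_case; [lra | now apply Rdiv_lt_0_compat]. }
  intros A B hA hB.
  replace (A * B - A0 * B0)
    with ((A - A0) * (B - B0) + (A - A0) * B0 + A0 * (B - B0)) by ring.
  pose proof (Rmin_l 1 (eps / M)); pose proof (Rmin_r 1 (eps / M)).
  set (d := Rmin 1 (eps / M)) in *.
  assert (hd : d * M <= eps).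
  { apply Rle_trans with (eps / M * M); [apply Rmult_le_compat_r; lra | right; field; lra]. }
  pose proof (Rabs_triang ((A - A0) * (B - B0) + (A - A0) * B0) (A0 * (B - B0))).
  pose proof (Rabs_triang ((A - A0) * (B - B0)) ((A - A0) * B0)).
  rewrite !Rabs_mult in *.
  pose proof (Rabs_pos (A - A0)); pose proof (Rabs_pos (B - B0)).
  unfold M in *; nra.
Qed.

(* Only the last variable of [G] is differentiated, so no regularity in [s] other
   than the continuity of [dG] at one point is required. *)
Lemma is_derive_increment (G dG : R -> R -> R) (u : R -> R) (t0 lu : R) :
  (forall s v, is_derive (G s) v (dG s v)) ->
  continuous (fun q : R * R => dG (fst q) (snd q)) (t0, u t0) ->
  is_derive u t0 lu ->
  is_derive (fun s => G s (u s) - G s (u t0)) t0 (dG t0 (u t0) * lu).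
Proof.
  intros hG hc hu; apply is_derive_Reals; intros eps heps.
  (* The difference quotient will become [dG] at an intermediate point times the difference quotient
     of [u]; [d] is the tolerance for each factor. *)
  destruct (mult_close (dG t0 (u t0)) lu eps heps) as (d & hd & hmul).
  assert (hcu : continuous u t0) by (apply (ex_derive_continuous u); now exists lu).
  apply is_derive_Reals in hu.
  destruct (hu d hd) as (d1 & hd1).
  destruct (proj1 (filterlim_locally _ _) hc (mkposreal d hd)) as (d2 & hd2).
  destruct (proj1 (filterlim_locally _ _) hcu d2) as (d3 & hd3).
  assert (hpos : 0 < Rmin d1 (Rmin d2 d3)).
  { repeat apply Rmin_case; apply cond_pos. }
  exists (mkposreal _ hpos); simpl; intros h hh hlt.
  assert (h1 : Rabs h < d1) by (eapply Rlt_le_trans; [exact hlt | apply Rmin_l]).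
  assert (h23 : Rabs h < Rmin d2 d3) by (eapply Rlt_le_trans; [exact hlt | apply Rmin_r]).
  assert (h2 : Rabs h < d2) by (eapply Rlt_le_trans; [exact h23 | apply Rmin_l]).
  assert (h3 : Rabs h < d3) by (eapply Rlt_le_trans; [exact h23 | apply Rmin_r]).
  specialize (hd1 h hh h1).
  assert (hb : forall r : R, Rabs h < r -> Rabs (t0 + h - t0) < r).
  { intros r; now replace (t0 + h - t0) with h by ring. }
  pose proof (hd3 (t0 + h) (hb _ h3)) as hu3.
  change (Rabs (u (t0 + h) - u t0) < d2) in hu3.
  (* Mean value theorem in the second argument, the first being frozen at [t0 + h]. The point [xi]
     lies between [u t0] and [u (t0 + h)], hence within [d2] of [u t0]. *)
  destruct (MVT_gen (G (t0 + h)) (u t0) (u (t0 + h)) (dG (t0 + h))) as (xi & hxi & e).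
  - intros v _; apply hG.
  - intros v _; apply continuity_pt_filterlim, (ex_derive_continuous (G (t0 + h))).
    eexists; apply hG.
  - rewrite e.
    replace ((dG (t0 + h) xi * (u (t0 + h) - u t0) - (G t0 (u t0) - G t0 (u t0))) / h)
      with (dG (t0 + h) xi * ((u (t0 + h) - u t0) / h)) by (field; exact hh).
    apply hmul; [| exact hd1].
    apply (hd2 (t0 + h, xi)); split; [now apply hb |].
    change (Rabs (xi - u t0) < d2).
    revert hxi hu3; unfold Rmin, Rmax, Rabs.
    repeat destruct Rle_dec; repeat destruct Rcase_abs; lra.
Qed.

Lemma continuous3_comp {T : UniformSpace} f (a b c : T -> R) (p : T) :
  continuous3 f -> continuous a p -> continuous b p -> continuous c p ->
  continuous (fun q => f (a q) (b q) (c q)) p.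
Proof.
  intros hf ha hb hc.
  apply (continuous_comp (fun q => (a q, b q, c q))
           (fun q : R * R * R => f (fst (fst q)) (snd (fst q)) (snd q))); [| apply hf].
  apply (continuous_comp_2 (fun q => (a q, b q)) c pair).
  - apply (continuous_comp_2 a b pair); [exact ha | exact hb |].
    apply (continuous_ext (fun q => q)); [now intros [] | apply continuous_id].
  - exact hc.
  - apply (continuous_ext (fun q => q)); [now intros [] | apply continuous_id].
Qed.

(** The increment of [f] telescopes: one coordinate moves at a time, with the earlier ones frozen at
    time [t] and the later ones still at time [s]. Each piece is an instance of
    [is_derive_increment]. *)
Lemma is_derive_curve f (a b c : R -> R) (t la lb lc : R) :
  class_C 1 f -> is_derive a t la -> is_derive b t lb -> is_derive c t lc ->
  is_derive (fun s => f (a s) (b s) (c s)) t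
    (D1 f (a t) (b t) (c t) * la + D2 f (a t) (b t) (c t) * lb
     + D3 f (a t) (b t) (c t) * lc).
Proof.
  intros (_ & hf & h1 & h2 & h3) ha hb hc.
  assert (ca : continuous a t) by (apply (ex_derive_continuous a); now exists la).
  assert (cb : continuous b t) by (apply (ex_derive_continuous b); now exists lb).
  assert (cc : continuous c t) by (apply (ex_derive_continuous c); now exists lc).
  assert (cfst : forall u : R -> R, continuous u t ->
            forall v, continuous (fun q : R * R => u (fst q)) (t, v : R)).
  { intros u hu v; apply (continuous_comp fst u); [apply continuous_fst | exact hu]. }
  assert (H1 : is_derive (fun s => f (a s) (b s) (c s) - f (a t) (b s) (c s)) t
            (D1 f (a t) (b t) (c t) * la)).
  { apply (is_derive_increment (fun s v => f v (b s) (c s))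
             (fun s v => D1 f v (b s) (c s)));
      [intros s v; apply Derive_correct; now apply derivable1 | | exact ha].
    apply continuous3_comp; auto; apply continuous_snd. }
  assert (H2 : is_derive (fun s => f (a t) (b s) (c s) - f (a t) (b t) (c s)) t
            (D2 f (a t) (b t) (c t) * lb)).
  { apply (is_derive_increment (fun s v => f (a t) v (c s)) (fun s v => D2 f (a t) v (c s)));
      [intros s v; apply Derive_correct; now apply derivable2 | | exact hb].
    apply continuous3_comp; auto; [apply continuous_const | apply continuous_snd]. }
  assert (H3 : is_derive (fun s => f (a t) (b t) (c s) - f (a t) (b t) (c t)) t
            (D3 f (a t) (b t) (c t) * lc)).
  { apply (is_derive_increment (fun s v => f (a t) (b t) v) (fun s v => D3 f (a t) (b t) v));
      [intros s v; apply Derive_correct; now apply derivable3 | | exact hc].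
    apply continuous3_comp; auto; [apply continuous_const .. | apply continuous_snd]. }
  pose proof (is_derive_plus _ _ _ _ _
    (is_derive_plus _ _ _ _ _ (is_derive_plus _ _ _ _ _ H1 H2) H3)
    (is_derive_const (f (a t) (b t) (c t)) t)) as H.
  evar_last.
  - refine (is_derive_ext _ _ _ _ _ H).
    intros s; unfold plus; simpl; ring.
  - unfold plus, zero; simpl; ring.
Qed.

(** * Scaling *)

Lemma is_derive_0_const (phi : R -> R) :
  (forall t, is_derive phi t 0) -> forall s t, phi s = phi t.
Proof.
  intros h s t; destruct (Rtotal_order s t) as [lt | [-> | gt]]; trivial.
  - apply eq_is_derive; [intros; apply h | exact lt].
  - symmetry; apply eq_is_derive; [intros; apply h | exact gt].
Qed.

Lemma D_scale f (a b c : R) : partially_derivable f ->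
  D1 (fun x y z => f (a * x) (b * y) (c * z)) =
    (fun x y z => a * D1 f (a * x) (b * y) (c * z)) /\
  D2 (fun x y z => f (a * x) (b * y) (c * z)) =
    (fun x y z => b * D2 f (a * x) (b * y) (c * z)) /\
  D3 (fun x y z => f (a * x) (b * y) (c * z)) =
    (fun x y z => c * D3 f (a * x) (b * y) (c * z)).
Proof.
  intros hf; split; [| split]; funext3; unfold D1, D2, D3.
  - rewrite (Derive_comp (fun t => f t _ _)); [| now apply derivable1 | auto_derive; trivial].
    rewrite Derive_scal, Derive_id; ring.
  - rewrite (Derive_comp (fun t => f _ t _)); [| now apply derivable2 | auto_derive; trivial].
    rewrite Derive_scal, Derive_id; ring.
  - rewrite (Derive_comp (fun t => f _ _ t)); [| now apply derivable3 | auto_derive; trivial].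
    rewrite Derive_scal, Derive_id; ring.
Qed.

(** The curve [(exp t * x, exp t * y, exp (-2 * t) * z)] has velocity [(X, Y, -2 Z)] at its point
    [(X, Y, Z)], so the hypothesis says that [f] has zero derivative along it. The parameter is
    [t = ln s]. *)
Lemma flow_invariant f : class_C 1 f ->
  (forall x y z, x * D1 f x y z + y * D2 f x y z - 2 * z * D3 f x y z = 0) ->
  forall s x y z, 0 < s -> f (s * x) (s * y) (/ s ^ 2 * z) = f x y z.
Proof.
  intros hf h s x y z hs.
  pose proof (is_derive_0_const
    (fun t => f (exp t * x) (exp t * y) (exp (- 2 * t) * z))) as hconst.
  assert (e : exp (-2 * ln s) = / s ^ 2).
  { replace (-2 * ln s) with (- (ln s + ln s)) by ring.
    rewrite exp_Ropp, exp_plus, exp_ln by exact hs; f_equal; ring. }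
  simpl in hconst; rewrite <- e, <- (exp_ln s hs) at 1.
  rewrite <- (exp_ln s hs) at 2.
  (* Time [ln s] is compared with time 0, where the flow is the identity. *)
  rewrite hconst with (t := 0).
  - rewrite Rmult_0_r, exp_0, !Rmult_1_l; reflexivity.
  - intros t.
    evar_last.
    + apply (is_derive_curve f (fun t => exp t * x) (fun t => exp t * y)
        (fun t => exp (-2 * t) * z) t (exp t * x) (exp t * y) (-2 * (exp (-2 * t) * z)) hf);
        auto_derive; trivial; ring.
    + simpl; rewrite <- (h (exp t * x) (exp t * y) (exp (-2 * t) * z)); ring.
Qed.

(** A single flow map, [s = 2], suffices: it multiplies the second derivatives in [x] and [y] by 4
    and the one in [z] by 1/16, and the Laplace equation holds at a point and at its image. *)
Lemma flow_invariant_D33 f : harmonic f ->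
  (forall s x y z, 0 < s -> f (s * x) (s * y) (/ s ^ 2 * z) = f x y z) ->
  forall x y z, D3 (D3 f) x y z = 0.
Proof.
  intros ((_ & hf & (_ & h1 & _) & (_ & h2 & _) & (_ & h3 & _)) & lap) inv x y z.
  set (c := / 2 ^ 2).
  assert (e : (fun x y z => f (2 * x) (2 * y) (c * z)) = f).
  { funext3; apply inv; lra. }
  assert (E1 : D1 (D1 f) x y z = 4 * D1 (D1 f) (2 * x) (2 * y) (c * z)).
  { rewrite <- e at 1; destruct (D_scale f 2 2 c hf) as (-> & _).
    unfold D1 at 1; rewrite Derive_scal.
    pose proof (proj1 (D_scale (D1 f) 2 2 c h1)) as s.
    apply (f_equal (fun g => g x y z)) in s; unfold D1 at 1 in s; rewrite s; ring. }
  assert (E2 : D2 (D2 f) x y z = 4 * D2 (D2 f) (2 * x) (2 * y) (c * z)).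
  { rewrite <- e at 1; destruct (D_scale f 2 2 c hf) as (_ & -> & _).
    unfold D2 at 1; rewrite Derive_scal.
    pose proof (proj1 (proj2 (D_scale (D2 f) 2 2 c h2))) as s.
    apply (f_equal (fun g => g x y z)) in s; unfold D2 at 1 in s; rewrite s; ring. }
  assert (E3 : D3 (D3 f) x y z = c * c * D3 (D3 f) (2 * x) (2 * y) (c * z)).
  { rewrite <- e at 1; destruct (D_scale f 2 2 c hf) as (_ & _ & ->).
    unfold D3 at 1; rewrite Derive_scal.
    pose proof (proj2 (proj2 (D_scale (D3 f) 2 2 c h3))) as s.
    apply (f_equal (fun g => g x y z)) in s; unfold D3 at 1 in s; rewrite s; ring. }
  pose proof (lap x y z) as l1; pose proof (lap (2 * x) (2 * y) (c * z)) as l2.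
  unfold laplacian in l1, l2.
  assert (hc : c * c = / 16) by (unfold c; field).
  (* With [w] the second [z]-derivative at the image point, the two Laplace equations give
     [-4 w + w / 16 = 0], so [w = 0]. *)
  rewrite hc in E3; lra.
Qed.

(** * Affine and homogeneous functions *)

Lemma Derive2_0_affine (phi : R -> R) :
  (forall t, ex_derive phi t) -> (forall t, is_derive (Derive phi) t 0) ->
  forall t, phi t = phi 0 + t * Derive phi t.
Proof.
  intros h1 h2 t.
  pose proof (is_derive_0_const _ h2) as hc.
  assert (e : phi t - t * Derive phi 0 = phi 0 - 0 * Derive phi 0).
  { apply (is_derive_0_const (fun s => phi s - s * Derive phi 0)).
    intros s; auto_derive; [apply h1 |].
    change (fun x => phi x) with phi; rewrite (hc s 0); ring. }
  rewrite (hc t 0); lra.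
Qed.

(** Serves to let [s] tend to 0 along the flow, which is available for [s > 0] only; hence the
    one-sided hypothesis. *)
Lemma continuous_const_right (phi : R -> R) (l : R) :
  continuous phi 0 -> (forall s, 0 < s -> phi s = l) -> phi 0 = l.
Proof.
  intros hc h.
  apply cond_eq; intros eps heps.
  destruct (proj1 (filterlim_locally _ _) hc (mkposreal eps heps)) as (d & hd).
  pose proof (cond_pos d).
  assert (hb : ball 0 d (d / 2)).
  { change (Rabs (d / 2 - 0) < d); rewrite Rminus_0_r, Rabs_pos_eq; lra. }
  specialize (hd _ hb); change (Rabs (phi (d / 2) - phi 0) < eps) in hd.
  rewrite h in hd by lra; now rewrite Rabs_minus_sym.
Qed.

(* The derivative at [t = 0] of [t g(x, y, z) = g(t x, t y, z)]. *)
Lemma homogeneous1_linear g : class_C 1 g ->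
  (forall s x y z, 0 < s -> g (s * x) (s * y) z = s * g x y z) ->
  forall x y z, g x y z = D1 g 0 0 z * x + D2 g 0 0 z * y.
Proof.
  intros hg hom x y z.
  assert (g0 : g 0 0 z = 0).
  { pose proof (hom 2 0 0 z ltac:(lra)) as e; rewrite Rmult_0_r in e; lra. }
  assert (hd : is_derive (fun t => g (t * x) (t * y) z) 0
                 (D1 g 0 0 z * x + D2 g 0 0 z * y)).
  { evar_last.
    - apply (is_derive_curve g (fun t => t * x) (fun t => t * y) (fun _ => z) 0 x y 0 hg);
        auto_derive; trivial; ring.
    - simpl; rewrite !Rmult_0_l; ring. }
  apply is_derive_Reals in hd.
  apply cond_eq; intros eps heps.
  destruct (hd eps heps) as (d & h); pose proof (cond_pos d).
  (* At a positive increment homogeneity applies, and the difference quotient is exactly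
     [g x y z]. *)
  specialize (h (d / 2)); rewrite Rplus_0_l, !Rmult_0_l, g0, hom in h by lra.
  replace ((d / 2 * g x y z - 0) / (d / 2)) with (g x y z) in h by (field; lra).
  apply h; [lra | rewrite Rabs_pos_eq; lra].
Qed.

(** * Determination of [f] from the Euler equation *)

Lemma flow_invariant_harmonic f : harmonic f ->
  (forall x y z, x * D1 f x y z + y * D2 f x y z - 2 * z * D3 f x y z = 0) ->
  exists alpha beta gamma : R, forall x y z : R,
    f x y z = alpha + beta * (x * y * z) + gamma * ((x ^ 2 - y ^ 2) * z).
Proof.
  intros hf euler.
  pose proof (class_C_S _ _ (proj1 hf)) as C1.
  pose proof (flow_invariant f C1 euler) as inv.
  pose proof (flow_invariant_D33 f hf inv) as h33.
  destruct hf as ((c0 & hf & h1 & h2 & h3) & lap).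
  pose proof (proj1 (proj2 h3)) as h3'.
  set (alpha := f 0 0 0).
  (* On the plane [z = 0] the flow contracts every point to the origin as [s] tends to 0, so
     continuity gives the value [f 0 0 0]. *)
  assert (bottom : forall x y, f x y 0 = alpha).
  { intros x y; unfold alpha.
    pose proof (continuous_const_right (fun s => f (s * x) (s * y) 0) (f x y 0)) as e.
    simpl in e; rewrite !Rmult_0_l in e; symmetry; apply e.
    - apply (continuous3_comp f (fun s => s * x) (fun s => s * y) (fun _ => 0)); trivial;
        [.. | apply continuous_const].
      + apply (ex_derive_continuous (fun s => s * x)); auto_derive; trivial.
      + apply (ex_derive_continuous (fun s => s * y)); auto_derive; trivial.
    - intros s hs; rewrite <- (inv s x y 0 hs), Rmult_0_r; reflexivity. }
  assert (affine : forall x y z, f x y z = alpha + z * D3 f x y z).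
  { intros x y z; rewrite <- (bottom x y).
    apply (Derive2_0_affine (fun t => f x y t)).
    - intros t; now apply derivable3.
    - intros t; rewrite <- (h33 x y t); apply (Derive_correct (fun s => D3 f x y s)).
      now apply derivable3. }
  assert (D3c : forall x y s t, D3 f x y s = D3 f x y t).
  { intros x y; apply (is_derive_0_const (fun t => D3 f x y t)).
    intros t; rewrite <- (h33 x y t); apply (Derive_correct (fun s => D3 f x y s)).
    now apply derivable3. }
  (* Thus [f - alpha] is homogeneous of degree 2 in [(x, y)]: invariance moves the scaling onto [z],
     where [f] is affine. The factor [1 * z] matches the shape of [D_scale]. *)
  assert (hom : forall s x y z, 0 < s ->
            f (s * x) (s * y) (1 * z) = s ^ 2 * f x y z + (1 - s ^ 2) * alpha).
  { intros s x y z hs.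
    replace (1 * z) with (/ s ^ 2 * (s ^ 2 * z)) by (field; lra).
    rewrite inv by exact hs.
    rewrite (affine x y (s ^ 2 * z)), (affine x y z), (D3c x y (s ^ 2 * z) z); ring. }
  (* Differentiating [hom] in [x] or [y] and cancelling one factor [s] leaves homogeneity of degree
     1, so these derivatives are linear in [(x, y)]. *)
  assert (hom' : forall s, 0 < s ->
    (forall x y z, D1 f (s * x) (s * y) z = s * D1 f x y z) /\
    (forall x y z, D2 f (s * x) (s * y) z = s * D2 f x y z)).
  { intros s hs.
    assert (e : (fun x y z => f (s * x) (s * y) (1 * z)) =
                (fun x y z => s ^ 2 * f x y z + (1 - s ^ 2) * alpha)).
    { funext3; now apply hom. }
    destruct (D_scale f s s 1 hf) as (e1 & e2 & _).
    rewrite e in e1, e2.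
    split; intros x y z.
    - apply (f_equal (fun g => g x y z)) in e1; unfold D1 at 1 in e1.
      rewrite Derive_plus, Derive_scal, Derive_const in e1;
        [| apply ex_derive_scal; now apply derivable1 | apply ex_derive_const].
      fold (D1 f x y z) in e1; rewrite Rmult_1_l in e1.
      apply Rmult_eq_reg_l with s; lra.
    - apply (f_equal (fun g => g x y z)) in e2; unfold D2 at 1 in e2.
      rewrite Derive_plus, Derive_scal, Derive_const in e2;
        [| apply ex_derive_scal; now apply derivable2 | apply ex_derive_const].
      fold (D2 f x y z) in e2; rewrite Rmult_1_l in e2.
      apply Rmult_eq_reg_l with s; lra. }
  pose proof (homogeneous1_linear (D1 f) h1 (fun s x y z hs => proj1 (hom' s hs) x y z)) as L1.
  pose proof (homogeneous1_linear (D2 f) h2 (fun s x y z hs => proj2 (hom' s hs) x y z)) as L2.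
  (* The Laplace equation makes the coefficients of [x ^ 2] and [y ^ 2] opposite. *)
  pose proof (lap 0 0 1) as l; unfold laplacian in l; rewrite h33 in l.
  set (a := D1 (D1 f) 0 0 1) in *.
  (* The Euler equation at height 1 reads [2 * D3 f x y 1 = x * D1 f x y 1 + y * D2 f x y 1].
     Inserting the linear forms and halving gives [beta] and [gamma]; both mixed derivatives
     contribute to the term in [x * y]. *)
  exists alpha, ((D2 (D1 f) 0 0 1 + D1 (D2 f) 0 0 1) / 2), (a / 2).
  intros x y z.
  pose proof (euler x y 1) as E; rewrite L1, L2 in E.
  fold a in E.
  replace (D2 (D2 f) 0 0 1) with (- a) in E by lra.
  rewrite affine, (D3c x y z 1).
  replace (D3 f x y 1) with
    ((x * (a * x + D2 (D1 f) 0 0 1 * y) + y * (D1 (D2 f) 0 0 1 * x + - a * y)) / 2) by lra.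
  field.
Qed.

Theorem theorem3 (f : R -> R -> R -> R) (hf : harmonic f) :
  harmonic (fun x y z => (x ^ 2 + y ^ 2 - 2 * z ^ 2) * f x y z) <->
  exists alpha beta gamma : R,
    forall x y z : R,
      f x y z = alpha + beta * (x * y * z) + gamma * ((x ^ 2 - y ^ 2) * z).
Proof.
  change (harmonic (fun x y z => cone x y z * f x y z) <->
    exists alpha beta gamma : R, forall x y z : R,
      f x y z = alpha + beta * (x * y * z) + gamma * ((x ^ 2 - y ^ 2) * z)).
  rewrite harmonic_cone_mult by exact hf.
  split; [now apply flow_invariant_harmonic |].
  (* Give [x] and [y] weight 1 and [z] weight -2: every monomial in the formula has weight 0, so the
     Euler operator annihilates it. *)
  intros (alpha & beta & gamma & e) x y z.
  assert (E : f = fun x y z =>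
    alpha + beta * (x * y * z) + gamma * ((x ^ 2 - y ^ 2) * z)) by (funext3; apply e).
  assert (d1 : D1 f x y z = beta * (y * z) + gamma * (2 * x * z)).
  { rewrite E; unfold D1; apply is_derive_unique; auto_derive; trivial; ring. }
  assert (d2 : D2 f x y z = beta * (x * z) - gamma * (2 * y * z)).
  { rewrite E; unfold D2; apply is_derive_unique; auto_derive; trivial; ring. }
  assert (d3 : D3 f x y z = beta * (x * y) + gamma * (x ^ 2 - y ^ 2)).
  { rewrite E; unfold D3; apply is_derive_unique; auto_derive; trivial; ring. }
  rewrite d1, d2, d3; ring.
Qed.
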